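(* Suppose $(S_t)$ is $l_0$-sub-gamma with variance process $(V_t)$ and scale parameter $c$. (a) For any $a,b>0$, we have $$\mathbb P(\exists t\in\mathcal T:S_t\ge a+bV_t)\le l_0\exp\left\{-\frac{2ab}{1+2cb}\right\}.$$ (b) For any $m,b>0$, we have $$\mathbb P(\exists t\in\mathcal T:V_t\ge m\text{ and }S_t\ge bV_t)\le l_0\exp\{-m\psi_G^\star(b)\}\le l_0\exp\left\{-\frac{b^2m}{2(1+cb)}\right\}.$$
   Context: Time index: either $\mathcal T=\mathbb N=\{1,2,\dots\}$ or $\mathcal T=(0,\infty)$. Processes are adapted to a filtration $(\mathcal F_t)_{t\in\mathcal T\cup\{0\}}$ with $\mathcal F_0$ trivial; in continuous time the filtration is right-continuous and complete and $(S_t),(V_t)$ are càdlàg. For real-valued adapted $(S_t),(V_t)$ with $S_0=V_0=0$ a.s. and $V_t\ge0$ a.s., $(S_t)$ is $l_0$-sub-gamma ($l_0\in[1,\infty)$) with scale parameter $c\in\mathbb R$ and variance process $(V_t)$ if for each $\lambda\in[0,1/(c\vee0))$ (with $1/0=\infty$) there is a supermartingale $(L_t(\lambda))_{t\in\mathcal T\cup\{0\}}$ with respect to $(\mathcal F_t)$ with $L_0(\lambda)\le l_0$ a.s. and $\exp\left\{\lambda S_t-\frac{\lambda^2}{2(1-c\lambda)}V_t\right\}\le L_t(\lambda)$ a.s. for all $t\in\mathcal T$. $\psi_G^\star(u)=\frac{u^2}{1+cu+\sqrt{1+2cu}}$ is the Legendre–Fenchel transform of $\psi_G(\lambda)=\frac{\lambda^2}{2(1-c\lambda)}$.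 *)

(* Defs.v *)
(* MathComp-Analysis. *)
From HB Require Import structures.
From mathcomp Require Import all_boot all_order all_algebra.
From mathcomp Require Import ring lra.
From mathcomp Require Import all_classical all_reals all_analysis.

Set Implicit Arguments.
Unset Strict Implicit.
Unset Printing Implicit Defensive.

Import Order.TTheory GRing.Theory Num.Theory.
Import numFieldNormedType.Exports.

Local Open Scope classical_set_scope.
Local Open Scope ring_scope.

(* Both time indices are subsets of R, so that processes and filtrations are
   families indexed by R; they are only ever constrained on 0 |` T (the values
   at other times are irrelevant). *)
Definition discrete_time (R : realType) : set R :=
  [set t | t \is a Num.nat /\ 0 < t].

Definition continuous_time (R : realType) : set R := [set t | 0 < t].

Arguments discrete_time R : clear implicits.
Arguments continuous_time R : clear implicits.

Section Processes.
Context (d : measure_display) (Omega : measurableType d) (R : realType).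
Context (P : probability Omega R).

Implicit Types (T : set R) (F : R -> set_system Omega) (G : set_system Omega).
Implicit Types (X Y : Omega -> R) (S V L : R -> Omega -> R).

Definition filtration T F :=
  [/\ forall t, (0 |` T) t -> sigma_algebra setT (F t),
      forall t, (0 |` T) t -> F t `<=` measurable &
      forall s t, (0 |` T) s -> (0 |` T) t -> s <= t -> F s `<=` F t].

(* Triviality is modulo P, as F 0 contains all null sets when the filtration
   is complete. *)
Definition trivial_events G := forall A, G A -> P A = 0%E \/ P A = 1%E.

Definition right_continuous_filtration F :=
  forall t, 0 <= t -> F t = \bigcap_(s in [set s | t < s]) F s.

Definition complete_filtration F := P.-negligible `<=` F 0.

Definition cadlag (f : R -> R) :=
  (forall t, 0 <= t -> f x @[x --> t^'+] --> f t) /\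
  (forall t, 0 < t -> cvg (f x @[x --> t^'-])).

Definition measurable_wrt G X :=
  forall B : set R, measurable B -> G (X @^-1` B).

Definition adapted T F S :=
  forall t, (0 |` T) t -> measurable_wrt (F t) (S t).

(* Y is a version of the conditional expectation E[X | G]. *)
Definition is_cond_exp G X Y :=
  [/\ measurable_wrt G Y, P.-integrable setT (EFin \o Y) &
      forall A, G A -> (\int[P]_(w in A) (Y w)%:E = \int[P]_(w in A) (X w)%:E)%E].

Definition supermartingale T F L :=
  [/\ adapted T F L,
      forall t, (0 |` T) t -> P.-integrable setT (EFin \o L t) &
      forall s t, (0 |` T) s -> (0 |` T) t -> s <= t ->
        exists2 Y, is_cond_exp (F s) (L t) Y & {ae P, forall w, Y w <= L s w}].

Definition psiG (c l : R) : R := l ^+ 2 / (2 * (1 - c * l)).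

(* The range [0, 1 / (c \/ 0)), computed in the extended reals, where the
   inverse of 0 is +oo. *)
Definition psiG_dom (c : R) : set R :=
  [set l | 0 <= l /\ (l%:E < 1 / (Num.max c 0)%:E)%E].

(* For c < 0 and 1 + 2 c u < 0, where the square root makes no sense, the
   Legendre-Fenchel transform of psiG is +oo; see psiG_starE. *)
Definition psiG_star (c u : R) : \bar R :=
  if 0 <= 1 + 2 * c * u then
    (u ^+ 2 / (1 + c * u + Num.sqrt (1 + 2 * c * u)))%:E
  else +oo%E.

Definition sub_gamma T F (l0 c : R) S V :=
  [/\ adapted T F S /\ adapted T F V,
      {ae P, forall w, S 0 w = 0} /\ {ae P, forall w, V 0 w = 0},
      forall t, T t -> {ae P, forall w, 0 <= V t w} &
      forall l, psiG_dom c l ->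
        exists L, [/\ supermartingale T F L,
          {ae P, forall w, L 0 w <= l0} &
          forall t, T t ->
            {ae P, forall w, expR (l * S t w - psiG c l * V t w) <= L t w}]].

End Processes.

Lemma psiG_starE (R : realType) (c u : R) : 0 < u ->
  psiG_star c u =
  ereal_sup [set (l * u - psiG c l)%:E | l in psiG_dom c].
Proof.
move=> u0.
have domE l : psiG_dom c l <-> 0 <= l /\ 0 < 1 - c * l.
  rewrite /psiG_dom /= mul1e inver.
  have [c0|c0] := ltP 0 c.
    rewrite (gt_eqF c0) lte_fin.
    rewrite -[X in (_ < X)]mul1r ltr_pdivlMr// mulrC.
    by split => -[l0 h]; split => //; lra.
  rewrite eqxx; split => -[l0 h]; split => //; last by rewrite ltry.
  by nra.
rewrite /psiG_star; case: ifPn => [D0|]; last first.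
  rewrite -ltNge => D0; apply/esym/eq_infty => r.
  have c0 : c < 0 by nra.
  pose k := u + (2 * c)^-1.
  have k0 : 0 < k.
    rewrite /k; have -> : u + (2 * c)^-1 = (1 + 2 * c * u) / (2 * c).
      by field; rewrite lt_eqF.
    by rewrite -mulrNN -invrN; apply: mulr_gt0; [|rewrite invr_gt0]; lra.
  pose l := `|r| / k.
  have l0 : 0 <= l by rewrite divr_ge0// ltW.
  have q0 : 0 < 1 - c * l by nra.
  apply: le_ereal_sup_tmp; exists (l * u - psiG c l)%:E.
    by exists l => //; apply/domE.
  rewrite lee_fin (@le_trans _ _ (l * k))//.
    by rewrite /l mulfVK ?gt_eqF// ler_norm.
  rewrite /k mulrDr lerD2l /psiG.
  have -> : l / (2 * c) = - (l ^+ 2 / (2 * (1 - c * l))) + l / (2 * c * (1 - c * l)).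
    by field; rewrite (gt_eqF q0) (lt_eqF c0).
  rewrite gerDl -mulrNN -invrN.
  rewrite mulNr oppr_le0 divr_ge0//.
  by have := mulr_gt0 (_ : 0 < - c) q0; rewrite oppr_gt0 => /(_ c0); nra.
set s := Num.sqrt _.
have s0 : 0 <= s by exact: sqrtr_ge0.
have sE : s ^+ 2 = 1 + 2 * c * u by rewrite /s sqr_sqrtr.
have s1 : 0 < 1 + s by lra.
have DE : 1 + c * u + s = (1 + s) ^+ 2 / 2.
  have -> : (1 + s) ^+ 2 = 1 + 2 * s + s ^+ 2 by ring.
  by rewrite sE; field.
have cE : c = (s ^+ 2 - 1) / (2 * u) by rewrite sE; field; rewrite gt_eqF.
have gap l : 0 < 1 - c * l -> u ^+ 2 / (1 + c * u + s) - (l * u - psiG c l) =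
    (2 * u - l * s * (1 + s)) ^+ 2 / (2 * (1 - c * l) * (1 + s) ^+ 2).
  move=> q0; rewrite DE /psiG.
  have : 1 - c * l != 0 by rewrite gt_eqF.
  rewrite cE => q1; field.
  rewrite (gt_eqF u0) (gt_eqF s1) /=.
  apply: contra q1 => /eqP q1; apply/eqP.
  by apply: (@mulIf _ (2 * u)); [rewrite gt_eqF//; lra|rewrite mul0r -q1; field; rewrite gt_eqF].
apply/eqP; rewrite eq_le; apply/andP; split; last first.
  apply: ge_ereal_sup => _ [l /domE[l0 q0] <-].
  rewrite lee_fin -subr_ge0 gap// divr_ge0 ?sqr_ge0//.
  by rewrite !mulr_ge0 ?sqr_ge0// ltW.
have [{}s0|sN0] := eqVneq s 0; last have {s0 sN0}s0 : 0 < s by rewrite lt_neqAle eq_sym sN0.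
  have q l : 1 - c * l = (2 * u + l) / (2 * u).
    by rewrite cE s0; field; rewrite gt_eqF.
  apply/lee_addgt0Pr => e e0.
  pose l := 4 * u ^+ 3 / e.
  have l0 : 0 < l by rewrite divr_gt0// mulr_gt0// exprn_gt0.
  have q0 : 0 < 1 - c * l by rewrite q divr_gt0//; lra.
  rewrite -leeBlDr//; apply: le_ereal_sup_tmp; exists (l * u - psiG c l)%:E.
    by exists l => //; apply/domE; split => //; exact: ltW.
  rewrite -EFinB lee_fin lerBlDl -lerBlDr gap// s0 q.
  have -> : (2 * u - l * 0 * (1 + 0)) ^+ 2 /
      (2 * ((2 * u + l) / (2 * u)) * (1 + 0) ^+ 2) = 4 * u ^+ 3 / (2 * u + l).
    by field; rewrite !gt_eqF//; lra.
  rewrite ler_pdivrMr; last by lra.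
  have -> : 4 * u ^+ 3 = e * l by rewrite /l; field; rewrite gt_eqF.
  by rewrite ler_wpM2l ?ltW//; lra.
pose l := 2 * u / (s * (1 + s)).
have ls : l * s * (1 + s) = 2 * u by rewrite /l; field; rewrite !gt_eqF.
have l0 : 0 <= l by rewrite divr_ge0// ?mulr_ge0// ltW.
have q0 : 0 < 1 - c * l.
  have -> : 1 - c * l = s^-1.
    rewrite cE /l; field; by rewrite !gt_eqF.
  by rewrite invr_gt0.
apply: le_ereal_sup_tmp; exists (l * u - psiG c l)%:E.
  by exists l => //; apply/domE.
by rewrite lee_fin -subr_le0 gap// ls subrr expr0n mul0r.
Qed.

(* Main.v *)
(* A nonnegative supermartingale L with L 0 <= l0 exceeds exp(r) at some time of
   a countable set with probability at most l0 exp(-r) (Ville).  Since the paths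
   of S and V are right-continuous, a crossing
   l S_t - psiG(l) V_t >= r at some t in T forces a crossing of level r - k, for
   any k > 0, at some time of a fixed countable set; letting k tend to 0 bounds
   the former by l0 exp(-r), with no path regularity of L.
   (a): a + b V <= S gives l S - psiG(l) V >= a l when psiG(l) <= l b; take l with
   psiG(l) = l b, and l -> +oo when 1 + 2 c b = 0 (this case needs V >= 0).
   (b): b V <= S and m <= V give l S - psiG(l) V >= m (l b - psiG(l)) when the
   right-hand side is nonnegative; then optimize over l. *)
Require Import Defs.
From mathcomp Require Import all_boot all_order all_algebra.
From mathcomp Require Import ring lra.
From mathcomp Require Import all_classical all_reals all_analysis.
From mathcomp Require Import measurable_realfun.

Set Implicit Arguments.
Unset Strict Implicit.

Import Order.TTheory GRing.Theory Num.Theory.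
Import numFieldNormedType.Exports.

Local Open Scope classical_set_scope.
Local Open Scope ring_scope.

(** * Maximal inequality over countably many times *)

Lemma sigma_algebra_setI (T : Type) (G : set (set T)) (A B : set T) :
  sigma_algebra setT G -> G A -> G B -> G (A `&` B).
Proof. by move=> /sigma_algebraP[]// _ _ _; exact. Qed.

Section MaximalInequality.
Context (d : measure_display) (Omega : measurableType d) (R : realType).
Context (P : probability Omega R).

(** Signed functions are allowed: [g - f] agrees almost everywhere on [A] with its absolute value,
    whose integral is nonnegative. *)
Lemma ae_le_integral_EFin (A : set Omega) (f g : Omega -> R) :
  measurable A ->
  P.-integrable A (EFin \o f) -> P.-integrable A (EFin \o g) ->
  {ae P, forall w, A w -> f w <= g w} ->
  (\int[P]_(w in A) (f w)%:E <= \int[P]_(w in A) (g w)%:E)%E.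
Proof.
move=> mA fi gi fg.
rewrite -sube_ge0; last first.
  by rewrite (integrable_fin_num mA fi).
rewrite -integralB_EFin//.
have /measurable_int mgf := integrableB mA gi fi.
rewrite (ae_eq_integral (fun w => `|(g w)%:E - (f w)%:E|)%E)//.
- by apply: integral_ge0 => w _; exact: abse_ge0.
- exact: measurableT_comp.
- by apply: filterS fg => w fg Aw; rewrite gee0_abs// sube_ge0// lee_fin fg.
Qed.

Lemma measurable_wrt_fun (G : set_system Omega) (X : Omega -> R) :
  G `<=` measurable -> measurable_wrt G X -> measurable_fun setT X.
Proof. by move=> Gm GX _ B mB; rewrite setTI; apply/Gm/GX. Qed.

Context (T : set R) (F : R -> set_system Omega).
Context (hF : filtration T F).

Lemma supermartingale_le_integral (L : R -> Omega -> R) (s t : R)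
    (A : set Omega) :
  supermartingale P T F L -> (0 |` T) s -> (0 |` T) t -> s <= t -> F s A ->
  (\int[P]_(w in A) (L t w)%:E <= \int[P]_(w in A) (L s w)%:E)%E.
Proof.
move=> [_ Li Lle] s0 t0 st FA.
have mA : measurable A by have [_ Fm _] := hF; exact: Fm FA.
have [Y [_ Yi YE] YL] := Lle _ _ s0 t0 st.
rewrite -YE//; apply: ae_le_integral_EFin => //.
- exact: integrableS Yi.
- by apply: integrableS (Li s s0).
- by apply: filterS YL.
Qed.

(* Splitting A according to whether L crosses x at the first time of the list keeps
   the event in the current sigma-algebra, so the optional-stopping argument is an
   induction on the list. *)
Lemma finite_Ville (L : R -> Omega -> R) (x : R) (ts : seq R) (s : R)
    (A : set Omega) :
  supermartingale P T F L -> 0 < x ->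
  (forall t B, (0 |` T) t -> F t B -> (0 <= \int[P]_(w in B) (L t w)%:E)%E) ->
  (0 |` T) s -> (forall t, t \in ts -> (0 |` T) t) -> path <=%R s ts -> F s A ->
  measurable (A `&` [set w | exists2 t, t \in ts & (x <= L t w)%R]) /\
  (x%:E * P (A `&` [set w | exists2 t, t \in ts & (x <= L t w)%R])
    <= \int[P]_(w in A) (L s w)%:E)%E.
Proof.
move=> sL x0 L0; have [LF Li _] := sL; have [Fs Fm Fle] := hF.
elim: ts s A => [|t ts IH] s A s0 ts0 /=.
  move=> _ FA; rewrite [X in A `&` X](_ : _ = set0) ?setI0.
    by rewrite measure0 mule0; split => //; exact: L0.
  by rewrite -subset0 => w [].
move=> /andP[st tts] FA.
have t0 : (0 |` T) t by apply: ts0; rewrite mem_head.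
have FtA : F t A by apply: Fle st _ FA.
pose U := L t @^-1` `[x, +oo[.
have FU : F t U by apply: LF => //; exact: measurable_itv.
have FUC : F t (~` U).
  by rewrite -setTD; have [_ + _] := Fs t t0; apply.
have FA1 : F t (A `&` U) by apply: sigma_algebra_setI => //; exact: Fs.
have FA2 : F t (A `&` ~` U) by apply: sigma_algebra_setI => //; exact: Fs.
have ts0' u : u \in ts -> (0 |` T) u.
  by move=> uts; apply: ts0; rewrite inE uts orbT.
have [mE IHA2] := IH t _ t0 ts0' tts FA2.
set E := _ `&` _ in mE IHA2.
have -> : A `&` [set w | exists2 u, u \in t :: ts & x <= L u w] =
    (A `&` U) `|` E.
  apply/seteqP; split => w /=.
    move=> [Aw [u]]; rewrite inE => /orP[/eqP->|uts] xu.
      by left; split => //; rewrite /U /= in_itv /= xu.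
    have [Uw|Uw] := pselect (U w); [by left|right].
    by split => //; exists u.
  rewrite /U /= => -[[Aw]|[[Aw _] [u uts xu]]].
    by rewrite in_itv /= andbT => xt; split => //; exists t; rewrite ?mem_head.
  by split => //; exists u => //; rewrite inE uts orbT.
have mA1 : measurable (A `&` U) by exact: Fm FA1.
have mA2 : measurable (A `&` ~` U) by exact: Fm FA2.
split; first exact: measurableU.
(* One supermartingale step replaces [L s] by [L t]. Then [L t >= x] on [U], and the induction
   hypothesis handles the part outside [U]. *)
apply: le_trans (supermartingale_le_integral sL s0 t0 st FA).
have AE : A = (A `&` U) `|` (A `&` ~` U) by rewrite -setIUr setUCr setIT.
have mL : measurable_fun setT (L t).
  by apply: measurable_wrt_fun (LF t t0); exact: Fm.
rewrite [X in (\int[P]_(w in X) _)%E]AE integral_setU//; last 2 first.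
- by apply: (measurable_funS measurableT) => //; exact/measurable_EFinP.
- by apply/disj_setPS => w [[_ ?] []].
apply: (@le_trans _ _ (x%:E * (P (A `&` U) + P E)))%E.
  by rewrite lee_pmul2l// measureU2.
rewrite ge0_muleDr ?measure_ge0//; apply: leeD => //.
rewrite -integral_cst//; apply: ae_le_integral_EFin => //.
- exact: finite_measure_integrable_cst.
- exact: integrableS (Li t t0).
- by apply: aeW => w [_]; rewrite /U /= in_itv /= andbT.
Qed.

Context (T_gt0 : forall t, T t -> 0 < t).

Lemma countable_Ville (L : R -> Omega -> R) (l0 x : R) (D : nat -> R) :
  supermartingale P T F L -> 0 < x -> (forall n, T (D n)) ->
  (forall t, T t -> {ae P, forall w, 0 <= L t w}) ->
  {ae P, forall w, L 0 w <= l0} ->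
  measurable (\bigcup_n [set w | x <= L (D n) w]) /\
  (P (\bigcup_n [set w | (x <= L (D n) w)%R]) <= (l0 / x)%:E)%E.
Proof.
move=> sL x0 TD LT Ll0; have [LF Li _] := sL; have [Fs Fm _] := hF.
have zero0 : (0 |` T) 0 by left.
have L0 t B : (0 |` T) t -> F t B -> (0 <= \int[P]_(w in B) (L t w)%:E)%E.
  move=> t0 FB; have mB : measurable B by exact: Fm FB.
  have int0 u : T u -> (0 <= \int[P]_(w in B) (L u w)%:E)%E.
    move=> Tu; have <- : (\int[P]_(w in B) (cst 0 w)%:E = 0)%E by rewrite integral0.
    apply: ae_le_integral_EFin => //; first exact: integrable0.
      by apply: (integrableS measurableT) => //; apply: Li; right.
    by apply: filterS (LT u Tu).
  (* The sign of [L] is given only on [T]; at time 0 the supermartingale property transfers it, for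
     integrals, from the later time [D 0]. *)
  case: (t0) => [tE|Tt]; last exact: int0.
  apply: le_trans (int0 _ (TD 0%N)) _.
  apply: supermartingale_le_integral => //; first by right.
  by rewrite tE ltW// T_gt0.
(* [D] need not be increasing, so its first [n] times are sorted before [finite_Ville] applies;
   continuity from below then gives the full union. *)
pose U n := \bigcup_(i < n) [set w | x <= L (D i) w].
have UE n : U n = setT `&`
    [set w | exists2 t, t \in sort <=%R (map D (iota 0 n)) & x <= L t w].
  rewrite setTI; apply/seteqP; split => w /=.
    move=> [i /= ilt xL]; exists (D i) => //.
    by rewrite mem_sort map_f// mem_iota.
  move=> [t]; rewrite mem_sort => /mapP[i]; rewrite mem_iota => /= ilt -> xL.
  by exists i.
have UP n : measurable (U n) /\ (P (U n) <= (l0 / x)%:E)%E.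
  have [|||] := @finite_Ville L x (sort <=%R (map D (iota 0 n))) 0 setT
    sL x0 L0 zero0.
  - by move=> t; rewrite mem_sort => /mapP[i _ ->]; right.
  - rewrite path_sortedE; last exact: le_trans.
    rewrite sort_sorted ?andbT; last exact: le_total.
    apply/allP => t; rewrite mem_sort => /mapP[i _ ->].
    by rewrite ltW// T_gt0.
  - by have [_ [F0 FC _]] := (zero0, Fs 0 zero0); rewrite -[setT]setD0; apply: FC.
  rewrite -UE => mU xP; split => //.
  rewrite EFinM lee_pdivlMr// muleC; apply: le_trans xP _.
  rewrite -[leRHS]mule1 -(probability_setT P) -integral_cst//.
  apply: ae_le_integral_EFin => //; first exact: Li.
    exact: finite_measure_integrable_cst.
  by apply: filterS Ll0.
have bigE : \bigcup_n [set w | x <= L (D n) w] = \bigcup_n U n.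
  apply/seteqP; split => w [n _].
    by move=> xL; exists n.+1 => //; exists n => //=.
  by move=> [i _ xL]; exists i.
have mU : measurable (\bigcup_n U n).
  by apply: bigcupT_measurable => n; have [] := UP n.
rewrite bigE; split => //.
apply: cvge_le (nondecreasing_cvg_mu _ mU _) => [|n|m n mn].
- by near=> n; have [] := UP n.
- by have [] := UP n.
- apply/subsetPset => w [i /= im xL]; exists i => //=.
  exact: leq_trans im mn.
Unshelve. all: by end_near. Qed.

End MaximalInequality.

(** * From countably many times to all times *)

Lemma outer_measure_le (d : measure_display) (Omega : measurableType d)
    (R : realType) (mu : {measure set Omega -> \bar R}) (E N U : set Omega) :
  mu.-negligible N -> measurable U -> E `<=` N `|` U -> (mu^*%mu E <= mu U)%E.
Proof.
move=> [N' [mN' N'0 NN']] mU EU.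
apply: (@le_trans _ _ (mu^*%mu (U `|` N'))).
  apply: le_mu_ext => w /EU[/NN'|]; by [right|left].
rewrite measurable_mu_extE; last exact: measurableU.
by rewrite measureU0.
Qed.

Section SubGamma.
Context (d : measure_display) (Omega : measurableType d) (R : realType).
Context (P : probability Omega R) (T : set R) (F : R -> set_system Omega).
Context (S V : R -> Omega -> R) (l0 c : R).

Lemma separable_paths :
  T = discrete_time R \/ T = continuous_time R ->
  (T = continuous_time R ->
    {ae P, forall w, cadlag (S ^~ w)} /\ {ae P, forall w, cadlag (V ^~ w)}) ->
  exists D : nat -> R, (forall n, T (D n)) /\
    {ae P, forall w, forall t, T t -> forall e, 0 < e ->
      exists n, `|S t w - S (D n) w| < e /\ `|V t w - V (D n) w| < e}.
Proof.
case=> [-> _|TE].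
  exists (fun n => n.+1%:R); split.
    by move=> n; split; [exact: natr_nat|rewrite ltr0n].
  apply: aeW => w t [/natrP[n ->]]; rewrite ltr0n => n0 e e0.
  by exists n.-1; rewrite prednK// !subrr normr0.
move=> /(_ TE)[cS cV].
(* [D] enumerates the positive rationals; every other code is sent to 1, which keeps [D] inside
   [T]. *)
pose D n : R := if unpickle n is Some q then
  if 0 < (ratr q : R) then ratr q else 1 else 1.
exists D; split.
  by move=> n; rewrite TE /continuous_time /D /=; case: unpickle => // q; case: ifP.
apply: filterS2 cS cV => w [Sw _] [Vw _] t.
rewrite TE /continuous_time /= => t0 e e0.
have /cvgrPdist_lt/(_ e e0) St := Sw t (ltW t0).
have /cvgrPdist_lt/(_ e e0) Vt := Vw t (ltW t0).
have /nbhs_ballP[r r0 near_t] : \forall s \near t, t < s ->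
    `|S t w - S s w| < e /\ `|V t w - V s w| < e.
  by apply: filterS2 St Vt => s Ss Vs; split.
have /rat_in_itvoo[q] : t < t + r by rewrite ltrDl.
rewrite in_itv /= => /andP[tq qr].
exists (pickle q); rewrite /D pickleK (lt_trans t0 tq).
apply: near_t => //; rewrite /ball /= distrC gtr0_norm ?subr_gt0//.
by rewrite ltrBlDl.
Qed.

Lemma psiG_domP (l : R) : psiG_dom c l <-> 0 <= l /\ 0 < 1 - c * l.
Proof.
rewrite /psiG_dom /= mul1e inver; have [c0|c0] := ltP 0 c.
  rewrite (gt_eqF c0) lte_fin -[X in (_ < X)]mul1r ltr_pdivlMr// mulrC subr_gt0.
  by split.
by rewrite eqxx; split => -[l0' _]; split; rewrite ?ltry//; nra.
Qed.

Context (hT : T = discrete_time R \/ T = continuous_time R).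
Context (hF : filtration T F).
Context (hcont : T = continuous_time R ->
  {ae P, forall w, cadlag (S ^~ w)} /\ {ae P, forall w, cadlag (V ^~ w)}).
Context (hSV : sub_gamma P T F l0 c S V).

Let T_gt0 t : T t -> 0 < t.
Proof. by case: hT => -> []. Qed.

Lemma linear_crossing_bound (l r : R) (E : set Omega) :
  0 < l0 -> psiG_dom c l ->
  (forall w, (forall t, T t -> 0 <= V t w) -> E w ->
     exists2 t, T t & r <= l * S t w - psiG c l * V t w) ->
  (P^*%mu E <= (l0 * expR (- r))%:E)%E.
Proof.
move=> l00 lc Er.
have [_ _ V0 /(_ l lc)[L [sL L0 XL]]] := hSV.
have [D [TD Dsep]] := separable_paths hT hcont.
apply/lee_addgt0Pr => e e0.
(* This [k] solves [l0 * expR (k - r) = l0 * expR (- r) + e]: lowering the level by [k] costs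
   exactly [e]. *)
pose k := ln (1 + e * expR r / l0).
have k0 : 0 < k.
  by rewrite ln_gt0// ltrDl divr_gt0// mulr_gt0// expR_gt0.
have <- : (l0 / expR (r - k))%:E = ((l0 * expR (- r))%:E + e%:E)%E.
  rewrite -EFinD -expRN opprB addrC expRD expRN lnK; last first.
    by rewrite posrE addr_gt0// divr_gt0// mulr_gt0// expR_gt0.
  by congr (_ %:E); field; rewrite !gt_eqF// expR_gt0.
have [|mU PU] := countable_Ville hF T_gt0 sL (expR_gt0 (r - k)) TD _ L0.
  by move=> t Tt; apply: filterS (XL t Tt) => w; apply: le_trans; exact: expR_ge0.
apply: le_trans PU.
(* The sign of [V] and the domination by [L] are required only at the times [D n], so that the
   exceptional set is negligible. *)
pose G w := [/\ forall t, T t -> forall e, 0 < e ->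
    exists n, `|S t w - S (D n) w| < e /\ `|V t w - V (D n) w| < e,
  forall n, 0 <= V (D n) w &
  forall n, expR (l * S (D n) w - psiG c l * V (D n) w) <= L (D n) w].
have Gae : {ae P, forall w, G w}.
  have V0' := ae_foralln (fun n => V0 _ (TD n)).
  have XL' := ae_foralln (fun n => XL _ (TD n)).
  by apply: filterS3 Dsep V0' XL' => w ? ? ?; split.
apply: (outer_measure_le Gae) => // w Ew.
have [Gw|] := pselect (G w); [right|by left].
have [sep V0w XLw] := Gw.
have Vw t : T t -> 0 <= V t w.
  move=> Tt; apply/ler_addgt0Pr => q q0.
  have [n [_ VDn]] := sep t Tt q q0.
  by have := V0w n; move: VDn; rewrite ltr_norml; lra.
have [t Tt rt] := Er w Vw Ew.
(* An error below [q] in both [S] and [V] moves [l * S - psiG c l * V] by at most [k]; the [+ 1]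
   keeps the denominator positive. *)
pose q := k / (`|l| + `|psiG c l| + 1).
have q0 : 0 < q by rewrite divr_gt0// ltr_wpDl// addr_ge0.
have [n [Sn Vn]] := sep t Tt q q0.
exists n => //=; apply: le_trans (XLw n); rewrite ler_expR.
have qk : (`|l| + `|psiG c l| + 1) * q = k.
  by rewrite /q mulrC divfK// gt_eqF// ltr_wpDl// addr_ge0.
have lS : l * S t w - l * S (D n) w <= `|l| * q.
  rewrite -mulrBr; apply: le_trans (ler_norm _) _.
  by rewrite normrM ler_wpM2l// ltW.
have pV : psiG c l * V (D n) w - psiG c l * V t w <= `|psiG c l| * q.
  rewrite -mulrBr; apply: le_trans (ler_norm _) _.
  by rewrite normrM ler_wpM2l// distrC ltW.
lra.
Qed.

End SubGamma.

(** * Optimization over [l] and the two bounds *)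

Lemma expeR_ereal_sup_bound (R : realType) (l0 m : R) (p : \bar R)
    (A : set (\bar R)) :
  0 < l0 -> 0 < m ->
  (forall y : R, A y%:E -> (p <= (l0 * expR (- (m * y)))%:E)%E) ->
  A `<=` range EFin -> A !=set0 ->
  (p <= l0%:E * expeR (- (m%:E * ereal_sup A)))%E.
Proof.
move=> l00 m0 pA AE [a Aa].
have [p0|p0] := leP p 0%E.
  by apply: le_trans p0 _; rewrite mule_ge0 ?expeR_ge0// lee_fin ltW.
have [a' _ a'E] := AE _ Aa; rewrite -a'E in Aa.
case: p pA p0 => [p| |] pA //; last by have := pA _ Aa.
rewrite lte_fin => p0.
(* For [p > 0], solving each bound for [y] gives one upper bound on all of [A], hence on its
   supremum. *)
have Aub : (ereal_sup A <= (- ln (p / l0) / m)%:E)%E.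
  apply: ge_ereal_sup => _ /[dup] /AE[y _ <-] /pA.
  rewrite !lee_fin mulrC -ler_pdivrMr// => py.
  rewrite ler_pdivlMr// mulrC lerNr -[leRHS]expRK.
  by rewrite ler_ln// posrE ?expR_gt0// divr_gt0.
apply: (@le_trans _ _ (l0%:E * expeR (- (m%:E * (- ln (p / l0) / m)%:E)))%E).
  rewrite -EFinM /= lee_fin.
  rewrite [m * _]mulrC divfK ?gt_eqF// opprK lnK ?posrE ?divr_gt0// mulrC divfK//.
  by rewrite gt_eqF.
by rewrite lee_pmul2l// lee_expeR leeN2 lee_pmul2l.
Qed.

(** Since [1 + 2 * c * b <= (1 + c * b) ^+ 2], the square root in [psiG_star] is at most
    [1 + c * b]. *)
Lemma psiG_star_ge (R : realType) (c b : R) : 0 < b ->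
  ((b ^+ 2)%:E / (2 * (1 + c * b))%:E <= psiG_star c b)%E.
Proof.
move=> b0; rewrite /psiG_star; case: ifPn => [D0|_]; last exact: leey.
have cb0 : 0 < 1 + c * b by lra.
rewrite inver gt_eqF ?mulr_gt0// -EFinM lee_fin.
set s := Num.sqrt _.
have s0 : 0 <= s by exact: sqrtr_ge0.
have sle : s <= 1 + c * b.
  rewrite -[leRHS]gtr0_norm// -sqrtr_sqr ler_wsqrtr//.
  by have := sqr_ge0 (c * b); lra.
rewrite ler_pM2l ?exprn_gt0// lef_pV2 ?posrE; lra.
Qed.

(* In continuous time the crossing events are uncountable unions over t, so the
   bounds are stated for the outer measure P^*, which equals P on measurable
   sets (measurable_mu_extE). Divisions in the bounds are in the extended
   reals: x / 0 = +oo for x > 0. *)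
Theorem corollary4 (d : measure_display) (Omega : measurableType d)
    (R : realType) (P : probability Omega R) (T : set R)
    (F : R -> set_system Omega) (S V : R -> Omega -> R) (l0 c : R)
    (hT : T = discrete_time R \/ T = continuous_time R)
    (hF : filtration T F)
    (hF0 : trivial_events P (F 0))
    (hcont : T = continuous_time R ->
      [/\ right_continuous_filtration F, complete_filtration P F,
          {ae P, forall w, cadlag (S ^~ w)} &
          {ae P, forall w, cadlag (V ^~ w)}])
    (hl0 : 1 <= l0)
    (hSV : sub_gamma P T F l0 c S V) :
  (forall a b : R, 0 < a -> 0 < b ->
     ((P^*)%mu [set w | exists2 t, T t & (S t w >= a + b * V t w)%R]
      <= l0%:E * expeR (- ((2 * a * b)%R%:E / (1 + 2 * c * b)%R%:E)))%E) /\
  (forall m b : R, 0 < m -> 0 < b ->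
     ((P^*)%mu [set w | exists2 t, T t & (V t w >= m)%R /\ (S t w >= b * V t w)%R]
      <= l0%:E * expeR (- (m%:E * psiG_star c b))
      <= l0%:E * expeR (- ((b ^+ 2 * m)%R%:E / (2 * (1 + c * b))%R%:E)))%E).
Proof.
have l00 : 0 < l0 by exact: lt_le_trans hl0.
have hcadlag : T = continuous_time R ->
    {ae P, forall w, cadlag (S ^~ w)} /\ {ae P, forall w, cadlag (V ^~ w)}.
  by move=> /hcont[].
have P1 E : (P^*%mu E <= 1)%E.
  rewrite -(probability_setT P) -measurable_mu_extE//; exact: le_mu_ext.
(* As [l0 >= 1], a bound with nonnegative exponent is at least 1; this settles the degenerate signs
   in both (a) and (b). *)
have P_le r E : 0 <= r -> (P^*%mu E <= (l0 * expR r)%:E)%E.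
  move=> r0; apply: le_trans (P1 E) _; rewrite lee_fin.
  by rewrite -[leLHS]mulr1 ler_pM// -expR0 ler_expR.
split=> [a b a0 b0|m b m0 b0].
  set E := [set w | _].
  have line l : 0 <= l -> 0 < 1 - c * l -> psiG c l <= l * b ->
      (P^*%mu E <= (l0 * expR (- (a * l)))%:E)%E.
    move=> l0' cl pb.
    apply: (linear_crossing_bound (l := l) hT hF hcadlag hSV) => //.
      by apply/psiG_domP.
    move=> w V0 [t Tt St]; exists t => //.
    have lS : l * (a + b * V t w) <= l * S t w by rewrite ler_wpM2l.
    have := ler_wpM2r (V0 t Tt) pb; lra.
  have [D0|D0|D0] := ltgtP (1 + 2 * c * b) 0.
  - rewrite inver lt_eqF//=.
    (* the exponent is nonnegative, so the bound is at least 1 *)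
    by apply: P_le; rewrite oppr_ge0 pmulr_rle0 ?mulr_gt0// invr_le0 ltW.
  - rewrite inver gt_eqF//=.
    (* The slope [l = 2 * b / (1 + 2 * c * b)] is the nonzero root of [psiG c l = l * b]. *)
    have -> : 2 * a * b / (1 + 2 * c * b) = a * (2 * b / (1 + 2 * c * b)).
      by field; rewrite gt_eqF.
    set D := 1 + 2 * c * b in D0 *.
    have E1 : 1 - c * (2 * b / D) = D^-1 by rewrite /D; field; rewrite gt_eqF.
    apply: line.
    + by rewrite divr_ge0 ?mulr_ge0// ltW.
    + by rewrite E1 invr_gt0.
    + by rewrite /psiG E1 [leLHS](_ : _ = 2 * b / D * b)//; field; rewrite gt_eqF.
  - rewrite D0 inver eqxx gt0_muley; last by rewrite lte_fin !mulr_gt0.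
    have supE : ereal_sup [set l%:E | l in [set l : R | 0 <= l]] = +oo%E.
      apply: eq_infty => r; apply: le_ereal_sup_tmp.
      exists `|r|%:E; [by exists `|r| => /=|by rewrite lee_fin ler_norm].
    (* Here the claimed bound is 0. The exponent is written as [a] times the supremum of all
       [l >= 0], each of which is admissible because [c < 0]. *)
    rewrite -(@gt0_muley _ a%:E) ?lte_fin// -supE.
    apply: expeR_ereal_sup_bound => //.
    + move=> _ [l /= l0' [<-]].
      have c0 : c < 0 by nra.
      apply: line => //; first by nra.
      have cl : 0 < 1 - c * l by nra.
      rewrite /psiG ler_pdivrMr ?mulr_gt0// -subr_ge0.
      have -> : l * b * (2 * (1 - c * l)) - l ^+ 2 =
          2 * l * b - (1 + 2 * c * b) * l ^+ 2 by ring.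
      by rewrite D0 mul0r subr0 !mulr_ge0// ltW.
    + by move=> _ [l _ <-]; exists l.
    + by exists 0%:E; exists 0 => /=.
apply/andP; split.
  rewrite psiG_starE//; apply: expeR_ereal_sup_bound => //.
  - move=> y [l /= lc [<-]].
    have [y0|y0] := leP 0 (l * b - psiG c l); last first.
      by apply: P_le; rewrite oppr_ge0 pmulr_rle0// ltW.
    apply: (linear_crossing_bound (l := l) hT hF hcadlag hSV) => //.
    move=> w _ [t Tt [mV St]]; exists t => //.
    have [l0' _] := lc.
    have := ler_wpM2l l0' St; have := ler_wpM2r y0 mV; lra.
  - by move=> _ [l _ <-]; exists (l * b - psiG c l).
  (* [l = 0] lies in the domain for every [c]. *)
  - exists (0 * b - psiG c 0)%:E; exists 0 => //.
    by apply/psiG_domP; rewrite mulr0 subr0.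
rewrite lee_pmul2l// lee_expeR leeN2 mulrC EFinM -muleA lee_pmul2l//.
exact: psiG_star_ge.
Qed.
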